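(* For every integer $n\ge2$ the set $\Delta_n'$ of monic polynomials $p\in\mathbb{Z}[x]$ of degree $n$ having $n$ different real roots, all of them positive, with $p(0)=(-1)^n$ and $p(1)\ne0$, is infinite. *)

(* Defs.v *)
From HB Require Import structures.
From mathcomp Require Import all_boot all_order all_algebra.
From mathcomp Require Import all_classical all_reals.

Set Implicit Arguments.
Unset Strict Implicit.
Unset Printing Implicit Defensive.

Import Order.TTheory GRing.Theory Num.Theory.
Local Open Scope classical_set_scope.
Local Open Scope card_scope.
Local Open Scope ring_scope.

Definition real_roots (R : realType) (p : {poly int}) : set R :=
  [set x : R | root (map_poly intr p) x].

Arguments real_roots : clear implicits.

Definition Delta' (R : realType) (n : nat) : set {poly int} :=
  [set p : {poly int} |
    [/\ p \is monic,
        size p = n.+1,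
        real_roots R p #= `I_n,
        (forall x : R, real_roots R p x -> 0 < x)
      & p.[0] = (-1) ^+ n /\ p.[1] != 0]].

Arguments Delta' : clear implicits.

(* Main.v *)
Require Import Defs.
From mathcomp Require Import all_boot all_order all_algebra.
From mathcomp Require Import all_classical all_reals.
From mathcomp Require Import polyrcf zify.

Import Order.TTheory GRing.Theory Num.Theory.
Local Open Scope classical_set_scope.
Local Open Scope ring_scope.

(** For a spacing [M >= 3] let
      [p = x (x - M) (x - 2 M) ... (x - (n - 1) M) + (-1)^n].
    At the integer points [t = j M - 1], [1 <= j <= n], the product has sign
    [(-1)^(n - j)] and absolute value at least [2], so [p(t)] has that sign
    too; and [p(0) = (-1)^n].  The [n] sign changes between [0 < M - 1 < 2 M - 1
    < ... < n M - 1] give [n] distinct positive roots.  For [M < N],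
    the polynomial of spacing [M] takes the value [(-1)^n] at [M], and that of
    spacing [N] does not, so different spacings give different polynomials. *)

(** The intermediate value theorem puts a root in each of [n] disjoint open intervals, and a
    polynomial of degree [n] has room for no others. *)
Lemma alternating_signs_roots {R : rcfType} {p : {poly R}} {n : nat}
    (t : nat -> R) :
  size p = n.+1 ->
  (forall j, (j < n)%N -> t j < t j.+1) ->
  (forall j, (j < n)%N -> p.[t j] * p.[t j.+1] < 0) ->
  exists x : nat -> R,
    [/\ {in (`I_n) &, injective x},
        (forall j, (j < n)%N -> t 0%N < x j)
      & [set y | root p y] = x @` `I_n].
Proof.
move=> szp tS pS.
have [x xP] : {x : nat -> R & forall j, (j < n)%N ->
    (x j \in `]t j, t j.+1[) /\ root p (x j)}.
  apply: (@choice _ _ (fun j y =>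
    (j < n)%N -> (y \in `]t j, t j.+1[) /\ root p y)) => j.
  have [jn|nj] := ltnP j n; last by exists 0 => ?; lia.
  by have [y ??] := poly_ivtoo (ltW (tS j jn)) (pS j jn); exists y.
have t_le i j : (i <= j)%N -> (j <= n)%N -> t i <= t j.
  elim: j => [|j IH]; first by rewrite leqn0 => /eqP->.
  rewrite leq_eqVlt => /orP[/eqP->//|ij] jn.
  exact: le_trans (IH ij (ltnW jn)) (ltW (tS j jn)).
have x_lt i j : (i < j)%N -> (j < n)%N -> x i < x j.
  move=> ij jn.
  have [] := xP i (ltn_trans ij jn); rewrite in_itv /= => /andP[_ xi] _.
  have [] := xP j jn; rewrite in_itv /= => /andP[xj _] _.
  exact: lt_trans (lt_le_trans xi (t_le _ _ ij (ltnW jn))) xj.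
have x_inj : {in (`I_n) &, injective x}.
  move=> i j; rewrite !inE /= => ni nj xij.
  by case: (ltngtP i j) => // h; [have := x_lt _ _ h nj|have := x_lt _ _ h ni];
    rewrite xij ltxx.
exists x; split=> // [j jn|].
  have [] := xP j jn; rewrite in_itv /= => /andP[xj _] _.
  exact: le_lt_trans (t_le _ _ (leq0n j) (ltnW jn)) xj.
(* As many distinct roots as the degree force a full splitting, so every root of [p] is some
   [x j]. *)
have pE : p = lead_coef p *: \prod_(z <- mkseq x n) ('X - z%:P).
  apply: all_roots_prod_XsubC; first by rewrite size_mkseq.
    by apply/allP=> _ /mapP[j + ->]; rewrite mem_iota => /= /xP[].
  rewrite uniq_rootsE; apply/mkseq_uniqP => i j; rewrite !inE => ni nj.
  by apply: x_inj; rewrite inE.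
have p0 : lead_coef p != 0 by rewrite lead_coef_eq0 -size_poly_eq0 szp.
apply/seteqP; split=> [y /=|y [j /= jn <-]]; last by have [] := xP j jn.
rewrite pE rootZ// root_prod_XsubC => /mapP[j].
by rewrite mem_iota /= => jn ->; exists j.
Qed.

Definition spaced_poly (n M : nat) : {poly int} :=
  \prod_(i < n) ('X - ((i * M)%N%:Z)%:P) + ((-1) ^+ n)%:P.

Lemma horner_spaced_poly (n M : nat) (x : int) :
  (spaced_poly n M).[x] = \prod_(i < n) (x - (i * M)%N%:Z) + (-1) ^+ n.
Proof.
rewrite /spaced_poly hornerD hornerC horner_prod; congr (_ + _).
by apply: eq_bigr => i _; rewrite hornerXsubC.
Qed.

Lemma size_spaced_prod {n M : nat} :
  size (\prod_(i < n) ('X - ((i * M)%N%:Z)%:P) : {poly int})%R = n.+1.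
Proof. by rewrite size_prod_XsubC /index_enum -enumT size_enum_ord. Qed.

Lemma size_spaced_poly_const {n M : nat} : (0 < n)%N ->
  (size (((-1) ^+ n)%:P : {poly int})%R <
   size (\prod_(i < n) ('X - ((i * M)%N%:Z)%:P) : {poly int})%R)%N.
Proof.
by move=> n0; rewrite size_spaced_prod (leq_ltn_trans (size_polyC_leq1 _)).
Qed.

Lemma size_spaced_poly {n M : nat} : (0 < n)%N ->
  size (spaced_poly n M) = n.+1.
Proof.
by move=> n0; rewrite size_polyDl ?size_spaced_poly_const// size_spaced_prod.
Qed.

Lemma spaced_poly_monic {n M : nat} : (0 < n)%N -> spaced_poly n M \is monic.
Proof.
move=> n0; rewrite monicE lead_coefDl ?size_spaced_poly_const//.
by rewrite -monicE monic_prod_XsubC.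
Qed.

Lemma spaced_poly0 {n M : nat} : (0 < n)%N ->
  (spaced_poly n M).[0] = (-1) ^+ n.
Proof.
by case: n => // n _; rewrite horner_spaced_poly big_ord_recl mul0n subrr mul0r
  add0r.
Qed.

(** Induction on [n] from [n = j.+1], where all factors are positive and the one at [i = 0] is at
    least 2. Each further factor is at most -1, and its sign is absorbed by the power of -1. *)
Lemma spaced_prod_sign {n M j : nat} : (3 <= M)%N -> (j < n)%N ->
  2 <= (-1) ^+ (n + j.+1) *
       \prod_(i < n) ((j.+1 * M)%N%:Z - 1 - (i * M)%N%:Z).
Proof.
move=> M3; elim: n => // n IH; rewrite ltnS leq_eqVlt => /orP[/eqP<-|jn].
  rewrite addnn -mul2n exprM sqrrN !expr1n mul1r big_ord_recl /=.
  have : 1 <= \prod_(i < j) ((j.+1 * M)%N%:Z - 1 - (bump 0 i * M)%N%:Z).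
    elim/big_ind: _ => // [x y ? ?|i _]; first by rewrite mulr_ege1.
    by rewrite /bump; have := ltn_ord i; nia.
  have : 2 <= (j.+1 * M)%N%:Z - 1 - (0 * M)%N%:Z by nia.
  set A := _ - _; set P := \prod_(_ < _) _; nia.
rewrite big_ord_recr /= addSn exprS mulN1r mulNr mulrA -mulrN.
have := IH jn; set P := _ * _.
have : 1 <= - ((j.+1 * M)%N%:Z - 1 - (n * M)%N%:Z) by nia.
nia.
Qed.

(** The uniform formula would give -1 at [j = 0]; starting at 0 instead keeps all the roots found
    positive. *)
Definition sign_point (M j : nat) : int :=
  if j is 0 then 0 else (j * M)%N%:Z - 1.

Lemma sign_point_lt {M j : nat} : (3 <= M)%N ->
  sign_point M j < sign_point M j.+1.
Proof. by case: j => [|j] M3 /=; nia. Qed.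

Lemma spaced_poly_sign {n M j : nat} : (3 <= M)%N -> (0 < n)%N -> (j <= n)%N ->
  0 < (-1) ^+ (n + j) * (spaced_poly n M).[sign_point M j].
Proof.
case: j => [|j] M3 n0 jn.
  by rewrite spaced_poly0// addn0 -exprD addnn -mul2n exprM sqrrN !expr1n.
rewrite horner_spaced_poly mulrDr; have := spaced_prod_sign M3 jn.
rewrite -exprD /=; set P := _ * _.
(* The constant term contributes 1 or -1, too little to cancel [P >= 2]. *)
rewrite -signr_odd; case: (odd _); rewrite ?expr0 ?expr1; lia.
Qed.

Lemma spaced_poly_sign_change {n M j : nat} : (3 <= M)%N -> (j < n)%N ->
  (spaced_poly n M).[sign_point M j] * (spaced_poly n M).[sign_point M j.+1] < 0.
Proof.
move=> M3 jn; have n0 : (0 < n)%N by lia.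
have := spaced_poly_sign M3 n0 (ltnW jn); have := spaced_poly_sign M3 n0 jn.
rewrite addnS exprS -signr_odd; case: (odd _); rewrite ?expr0 ?expr1; nia.
Qed.

(** At 1 the first two factors are 1 and [1 - M], and the others are nonzero integers, so the
    product has absolute value at least 2 and cannot cancel the constant term. *)
Lemma spaced_poly1_neq0 {n M : nat} : (3 <= M)%N -> (2 <= n)%N ->
  (spaced_poly n M).[1] != 0.
Proof.
case: n => [|[|n]]// M3 _; rewrite horner_spaced_poly 2!big_ord_recl /=.
have : 1 <= `|\prod_(i < n) (1 - (bump 0 (bump 0 i) * M)%N%:Z)|.
  rewrite normr_prod; elim/big_ind: _ => // [x y ? ?|i _].
    by rewrite mulr_ege1.
  by rewrite /bump; nia.
set P := \prod_(_ < _) _; rewrite /bump /= -signr_odd.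
case: (odd _); rewrite ?expr0 ?expr1; nia.
Qed.

Lemma spaced_poly_Delta' (R : realType) (n M : nat) :
  (3 <= M)%N -> (2 <= n)%N -> Delta' R n (spaced_poly n M).
Proof.
move=> M3 n2; have n0 : (0 < n)%N by lia.
have int_inj : injective (intr : int -> R) by exact: intr_inj.
have [|j _|j jn|x [x_inj x_gt rootsE]] := @alternating_signs_roots R
    (map_poly intr (spaced_poly n M)) n (intr \o sign_point M).
- by rewrite size_map_inj_poly// size_spaced_poly.
- by rewrite ltr_int sign_point_lt.
- by rewrite !horner_map /= -rmorphM /= ltrz0 spaced_poly_sign_change.
have {}rootsE : real_roots R (spaced_poly n M) = x @` `I_n := rootsE.
split.
- exact: spaced_poly_monic.
- exact: size_spaced_poly.
- by rewrite rootsE; exact: inj_card_eq.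
- by move=> y; rewrite rootsE => -[j jn <-]; have := x_gt j jn; rewrite /= mulr0z.
- by rewrite spaced_poly0// spaced_poly1_neq0.
Qed.

Lemma spaced_poly_neq {n M N : nat} : (0 < M)%N -> (M < N)%N -> (2 <= n)%N ->
  spaced_poly n M != spaced_poly n N.
Proof.
move=> M0 MN n2; apply/eqP => /(congr1 (horner^~ M%:Z)).
rewrite !horner_spaced_poly => /addIr/esym/eqP.
(* The factor of index 1 kills the product of spacing [M] at [M]. For spacing [N] no factor
   [M - i * N] vanishes: it is positive at [i = 0] and negative from [i = 1] on. *)
rewrite [X in _ == X](bigD1 (Ordinal n2))//= mul1n subrr mul0r.
apply/negP/prodf_neq0 => -[[|i] ni] _ /=; first by lia.
by rewrite subr_eq0; apply/eqP; nia.
Qed.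

Theorem lemma7p13 (R : realType) (n : nat) (hn : (2 <= n)%N) :
  infinite_set (Delta' R n).
Proof.
(* The shift by 3 makes every spacing admissible. *)
pose f k := spaced_poly n k.+3.
apply: (@sub_infinite_set _ (range f)).
  by move=> _ [k _ <-]; exact: spaced_poly_Delta'.
rewrite (eq_finite_set (inj_card_eq _)); first exact: infinite_nat.
move=> k l _ _ fkl; case: (ltngtP k l) => // h.
  by have := @spaced_poly_neq n k.+3 l.+3 isT h hn; rewrite -/(f _) fkl eqxx.
by have := @spaced_poly_neq n l.+3 k.+3 isT h hn; rewrite -/(f _) -fkl eqxx.
Qed.
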